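(* A finitely generated group admits a presentation in EDT0L if and only if it admits a finite L-presentation. Equivalently, $\pi(\text{EDT0L})=\pi(\text{DTF0L+FIN})$, i.e. a finitely generated group admits a presentation in EDT0L if and only if it admits a presentation in DTF0L+FIN.
   Context: All alphabets and generating sets are finite. For an alphabet $A$, $A^*$ is the free monoid on $A$; ''morphism'' of free monoids means monoid homomorphism. For a set $\Phi$ of maps, $\Phi^n(w)$ is the set of images of $w$ under all compositions of $n$ elements of $\Phi$ (with $\Phi^0(w)=\{w\}$), and $\Phi^n(W)=\bigcup_{w\in W}\Phi^n(w)$. Language families over $A$. A DTF0L language is one of the form $\bigcup_{n\ge 0}\Phi^n(W_0)$, where $W_0\subseteq A^*$ is finite and $\Phi$ is a finite set of morphisms $A^*\to A^*$. A language is in DTF0L+FIN if it is the union of a DTF0L language and a finite language. An EDT0L language over $A$ is one of the form $A^*\cap\bigcup_{n\ge 0}\Phi^n(w_0)$, where $A_E$ is a finite alphabet disjoint from $A$ (the non-terminals), $w_0\in (A\cup A_E)^*$, and $\Phi$ is a finite set of morphisms $(A\cup A_E)^*\to (A\cup A_E)^*$. Presentations. For a family of languages LAN, a group $G$ admits a presentation in LAN if for some finite set $S$ there is a language $R\subseteq (S\cup S^{-1})^*$ in LAN, over the alphabet $S\cup S^{-1}$, with $G\cong \mathbb{F}_S/\langle\langle R\rangle\rangle$, where $\mathbb{F}_S$ is the free group on $S$ and $\langle\langle R\rangle\rangle$ is the normal closure. $\pi(\text{LAN})$ is the class of finitely generated groups admitting a presentation in LAN. $G$ admits a finite L-presentation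 if for some finite set $S$ there are finite sets $Q,R\subseteq\mathbb{F}_S$ and a finite set $\Phi$ of group endomorphisms of $\mathbb{F}_S$ with $G\cong \mathbb{F}_S/\langle\langle Q\cup\bigcup_{n\ge 0}\Phi^n(R)\rangle\rangle$. *)

(* Defs.v *)
From HB Require Import structures.
From mathcomp Require Import all_boot.
From mathcomp Require Import boolp classical_sets functions cardinality.

Set Implicit Arguments.
Unset Strict Implicit.
Unset Printing Implicit Defensive.

Local Open Scope classical_set_scope.
Local Open Scope group_scope.
Local Open Scope quotient_scope.

(* [seq A] is the free monoid on [A], so that [monoid_morphism] below always
   refers to the library's notion, for words as well as for groups. *)
HB.instance Definition _ (A : choiceType) :=
  isMonoid.Build (seq A) (@catA A) (@cat0s A) (@cats0 A).

Section Iteration.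
Variable T : Type.
Implicit Types (Phi : set (T -> T)) (W : set T).

Fixpoint compositions Phi (n : nat) : set (T -> T) :=
  if n is m.+1 then [set f \o g | f in Phi & g in compositions Phi m]
  else [set id].

Definition images Phi n W : set T :=
  \bigcup_(w in W) [set h w | h in compositions Phi n].

Definition iterated_images Phi W : set T := \bigcup_n images Phi n W.

End Iteration.

Definition lang_family := forall A : finType, set (set (seq A)).

Definition DTF0L : lang_family := fun A =>
  [set L | exists (W0 : set (seq A)) (Phi : set (seq A -> seq A)),
     [/\ finite_set W0, finite_set Phi,
         (forall f, Phi f -> monoid_morphism f)
       & L = iterated_images Phi W0]].

Definition DTF0L_FIN : lang_family := fun A =>
  [set L | exists L1 L2 : set (seq A),
     [/\ DTF0L L1, finite_set L2 & L = L1 `|` L2]].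

(* The terminals [A] and the non-terminals [E] are made disjoint by taking the
   sum type [A + E]; intersecting with the words over [A] is then taking the
   preimage under the embedding [map inl]. *)
Definition EDT0L : lang_family := fun A =>
  [set L | exists (E : finType) (w0 : seq (A + E)%type)
              (Phi : set (seq (A + E)%type -> seq (A + E)%type)),
     [/\ finite_set Phi,
         (forall f, Phi f -> monoid_morphism f)
       & L = map inl @^-1` iterated_images Phi [set w0]]].

Section Subgroups.
Variable G : groupType.

Definition is_subgroup (H : set G) : Prop :=
  [/\ H 1, (forall x y, H x -> H y -> H (x * y)) & (forall x, H x -> H x^-1)].

Definition is_normal_subgroup (H : set G) : Prop :=
  is_subgroup H /\ (forall x y, H x -> H (x ^ y)).

Definition normal_closure (X : set G) : set G := smallest is_normal_subgroup X.

Definition finitely_generated : Prop :=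
  exists X : set G, finite_set X /\ smallest is_subgroup X = setT.

Lemma normal_closure_normal X : is_normal_subgroup (normal_closure X).
Proof.
split; first split.
- by move=> N [[[]]].
- by move=> x y Hx Hy N HN; case: (HN) => [[[_ HM _] _] _];
    apply: HM; [apply: Hx | apply: Hy].
- by move=> x Hx N HN; case: (HN) => [[[_ _ HV] _] _]; apply: HV; apply: Hx.
- by move=> x y Hx N HN; case: (HN) => [[_ HJ] _]; apply: HJ; apply: Hx.
Qed.

End Subgroups.

Definition isomorphic_groups (G H : groupType) : Prop :=
  exists f : G -> H, monoid_morphism f /\ bijective f.

Section QuotientGroup.
Variables (G : groupType) (X : set G).

Definition ncl_rel : rel G := fun x y => `[< normal_closure X (x^-1 * y) >].

Local Notation N := (normal_closure X).

Local Lemma ncl1 : N 1.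
Proof. by have [[]] := normal_closure_normal X. Qed.
Local Lemma nclM x y : N x -> N y -> N (x * y).
Proof. by have [[_ + _] _] := normal_closure_normal X; apply. Qed.
Local Lemma nclV x : N x -> N x^-1.
Proof. by have [[_ _ +] _] := normal_closure_normal X; apply. Qed.
Local Lemma nclJ x y : N x -> N (x ^ y).
Proof. by have [_ +] := normal_closure_normal X; apply. Qed.

Local Lemma ncl_refl : reflexive ncl_rel.
Proof. by move=> x; apply/asboolP; rewrite mulVg; apply: ncl1. Qed.

Local Lemma ncl_sym : symmetric ncl_rel.
Proof.
move=> x y; apply/asboolP/asboolP => /nclV; by rewrite invgM invgK.
Qed.

Local Lemma ncl_trans : transitive ncl_rel.
Proof.
move=> y x z /asboolP Nxy /asboolP Nyz; apply/asboolP.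
by have := nclM Nxy Nyz; rewrite -mulgA mulVKg.
Qed.

Canonical ncl_equiv := EquivRel ncl_rel ncl_refl ncl_sym ncl_trans.

(* The group [G / <<X>>], as the set of cosets of the normal closure of [X]. *)
Definition quotient_group := {eq_quot ncl_equiv}.

HB.instance Definition _ := Choice.on quotient_group.
HB.instance Definition _ := EqQuotient.on quotient_group.

Definition quotient_group_one : quotient_group := \pi_quotient_group 1.
Definition quotient_group_mul (p q : quotient_group) : quotient_group :=
  \pi_quotient_group (repr p * repr q).
Definition quotient_group_inv (p : quotient_group) : quotient_group :=
  \pi_quotient_group (repr p)^-1.

Lemma quotient_group_piP x y :
  \pi_quotient_group x = \pi_quotient_group y <-> N (x^-1 * y).
Proof. by split=> [/eqmodP/asboolP|Nxy] //; apply/eqmodP/asboolP. Qed.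

Local Lemma repr_pi x : N (x^-1 * repr (\pi_quotient_group x)).
Proof. by apply/quotient_group_piP; rewrite reprK. Qed.

Lemma quotient_group_piM x y : \pi_quotient_group (x * y) =
  quotient_group_mul (\pi_quotient_group x) (\pi_quotient_group y).
Proof.
apply/quotient_group_piP.
set x' := repr _; set y' := repr _.
have -> : (x * y)^-1 * (x' * y') = (x^-1 * x') ^ y * (y^-1 * y').
  by rewrite /conjg invgM -!mulgA mulVKg.
by apply: nclM; [apply: nclJ|]; apply: repr_pi.
Qed.

Lemma quotient_group_piV x : \pi_quotient_group x^-1 =
  quotient_group_inv (\pi_quotient_group x).
Proof.
apply/quotient_group_piP; rewrite invgK.
set x' := repr _.
have -> : x * x'^-1 = ((x^-1 * x')^-1) ^ x^-1.
  by rewrite /conjg invgM !invgK -!mulgA mulgV mulg1.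
by apply: nclJ; apply: nclV; apply: repr_pi.
Qed.

Lemma quotient_group_ind (P : quotient_group -> Prop) :
  (forall x, P (\pi_quotient_group x)) -> forall p, P p.
Proof. by move=> Ppi p; rewrite -[p]reprK. Qed.

Local Lemma quotient_group_mulA : associative quotient_group_mul.
Proof.
elim/quotient_group_ind=> x; elim/quotient_group_ind=> y.
elim/quotient_group_ind=> z.
by rewrite -!quotient_group_piM mulgA.
Qed.
Local Lemma quotient_group_mul1g :
  left_id quotient_group_one quotient_group_mul.
Proof. by elim/quotient_group_ind=> x; rewrite -quotient_group_piM mul1g. Qed.
Local Lemma quotient_group_mulg1 :
  right_id quotient_group_one quotient_group_mul.
Proof. by elim/quotient_group_ind=> x; rewrite -quotient_group_piM mulg1. Qed.
Local Lemma quotient_group_mulVg :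
  left_inverse quotient_group_one quotient_group_inv quotient_group_mul.
Proof.
elim/quotient_group_ind=> x.
by rewrite -quotient_group_piV -quotient_group_piM mulVg.
Qed.
Local Lemma quotient_group_mulgV :
  right_inverse quotient_group_one quotient_group_inv quotient_group_mul.
Proof.
elim/quotient_group_ind=> x.
by rewrite -quotient_group_piV -quotient_group_piM mulgV.
Qed.

HB.instance Definition _ := isGroup.Build quotient_group
  quotient_group_mulA quotient_group_mul1g quotient_group_mulg1
  quotient_group_mulVg quotient_group_mulgV.

End QuotientGroup.

Section FreeGroup.
Variable S : finType.

(* The alphabet [S \cup S^{-1}]: [(s, false)] stands for [s] and [(s, true)]
   for its formal inverse. *)
Definition letter : finType := (S * bool)%type.

Definition letter_inv (a : letter) : letter := (a.1, ~~ a.2).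

Lemma letter_invK : involutive letter_inv.
Proof. by case=> s b; rewrite /letter_inv negbK. Qed.

Inductive free_eq : seq letter -> seq letter -> Prop :=
| free_eq_cancel u a v : free_eq (u ++ a :: letter_inv a :: v) (u ++ v)
| free_eq_refl u : free_eq u u
| free_eq_sym u v : free_eq u v -> free_eq v u
| free_eq_trans u v w : free_eq u v -> free_eq v w -> free_eq u w.

Lemma free_eq_cat u u' v v' :
  free_eq u u' -> free_eq v v' -> free_eq (u ++ v) (u' ++ v').
Proof.
move=> uu' vv'; apply: (@free_eq_trans _ (u' ++ v)).
  elim: uu' {vv'} => [x a y|x|x y _ IH|x y z _ IH1 _ IH2].
  - by rewrite -!catA !cat_cons; apply: free_eq_cancel.
  - exact: free_eq_refl.
  - exact: free_eq_sym.
  - exact: free_eq_trans IH1 IH2.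
elim: vv' {uu'} => [x a y|x|x y _ IH|x y z _ IH1 _ IH2].
- by rewrite !catA; apply: free_eq_cancel.
- exact: free_eq_refl.
- exact: free_eq_sym.
- exact: free_eq_trans IH1 IH2.
Qed.

Definition word_inv (u : seq letter) : seq letter := rev (map letter_inv u).

Lemma word_invK : involutive word_inv.
Proof.
by move=> u; rewrite /word_inv map_rev revK -map_comp map_id_in // => a _;
  rewrite /= letter_invK.
Qed.

Lemma free_eq_mulwV u : free_eq (u ++ word_inv u) [::].
Proof.
elim/last_ind: u => [|u a IH]; first exact: free_eq_refl.
rewrite /word_inv map_rcons rev_rcons cat_rcons.
exact: free_eq_trans (free_eq_cancel _ _ _) IH.
Qed.

Lemma free_eq_mulVw u : free_eq (word_inv u ++ u) [::].
Proof. by rewrite -{2}(word_invK u); apply: free_eq_mulwV. Qed.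

Lemma free_eq_inv u v : free_eq u v -> free_eq (word_inv u) (word_inv v).
Proof.
elim=> [x a y|x|x y _ IH|x y z _ IH1 _ IH2].
- rewrite /word_inv !map_cat /= !rev_cat !rev_cons -!cats1 -!catA letter_invK.
  exact: free_eq_cancel.
- exact: free_eq_refl.
- exact: free_eq_sym.
- exact: free_eq_trans IH1 IH2.
Qed.

Definition free_rel : rel (seq letter) := fun u v => `[< free_eq u v >].

Local Lemma free_rel_refl : reflexive free_rel.
Proof. by move=> u; apply/asboolP/free_eq_refl. Qed.
Local Lemma free_rel_sym : symmetric free_rel.
Proof. by move=> u v; apply/asboolP/asboolP => /free_eq_sym. Qed.
Local Lemma free_rel_trans : transitive free_rel.
Proof.
move=> v u w /asboolP uv /asboolP vw; apply/asboolP.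
exact: free_eq_trans uv vw.
Qed.

Canonical free_equiv :=
  EquivRel free_rel free_rel_refl free_rel_sym free_rel_trans.

Definition free_group := {eq_quot free_equiv}.

HB.instance Definition _ := Choice.on free_group.
HB.instance Definition _ := EqQuotient.on free_group.

Definition word_val (u : seq letter) : free_group := \pi_free_group u.

Definition free_group_one : free_group := word_val [::].
Definition free_group_mul (p q : free_group) : free_group :=
  word_val (repr p ++ repr q).
Definition free_group_inv (p : free_group) : free_group :=
  word_val (word_inv (repr p)).

Lemma word_valP u v : word_val u = word_val v <-> free_eq u v.
Proof. by split=> [/eqmodP/asboolP|uv] //; apply/eqmodP/asboolP. Qed.

Local Lemma repr_word_val u : free_eq u (repr (word_val u)).
Proof. by apply/word_valP; rewrite /word_val reprK. Qed.

Lemma word_val_cat u v :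
  word_val (u ++ v) = free_group_mul (word_val u) (word_val v).
Proof. by apply/word_valP/free_eq_cat; apply: repr_word_val. Qed.

Lemma word_val_inv u :
  word_val (word_inv u) = free_group_inv (word_val u).
Proof. by apply/word_valP/free_eq_inv/repr_word_val. Qed.

Lemma free_group_ind (P : free_group -> Prop) :
  (forall u, P (word_val u)) -> forall p, P p.
Proof. by move=> Pval p; rewrite -[p]reprK; apply: Pval. Qed.

Local Lemma free_group_mulA : associative free_group_mul.
Proof.
elim/free_group_ind=> x; elim/free_group_ind=> y; elim/free_group_ind=> z.
by rewrite -!word_val_cat catA.
Qed.
Local Lemma free_group_mul1g : left_id free_group_one free_group_mul.
Proof. by elim/free_group_ind=> x; rewrite -word_val_cat. Qed.
Local Lemma free_group_mulg1 : right_id free_group_one free_group_mul.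
Proof. by elim/free_group_ind=> x; rewrite -word_val_cat cats0. Qed.
Local Lemma free_group_mulVg :
  left_inverse free_group_one free_group_inv free_group_mul.
Proof.
elim/free_group_ind=> x; rewrite -word_val_inv -word_val_cat.
by apply/word_valP/free_eq_mulVw.
Qed.
Local Lemma free_group_mulgV :
  right_inverse free_group_one free_group_inv free_group_mul.
Proof.
elim/free_group_ind=> x; rewrite -word_val_inv -word_val_cat.
by apply/word_valP/free_eq_mulwV.
Qed.

HB.instance Definition _ := isGroup.Build free_group
  free_group_mulA free_group_mul1g free_group_mulg1
  free_group_mulVg free_group_mulgV.

End FreeGroup.

Definition has_presentation_in (LAN : lang_family) (G : groupType) : Prop :=
  exists (S : finType) (R : set (seq (letter S))),
    LAN (letter S) R /\
    isomorphic_groups G (quotient_group (@word_val S @` R)).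

Definition fg_groups_presented_in (LAN : lang_family) (G : groupType) : Prop :=
  finitely_generated G /\ has_presentation_in LAN G.

Definition has_finite_L_presentation (G : groupType) : Prop :=
  exists (S : finType) (Q R : set (free_group S))
         (Phi : set (free_group S -> free_group S)),
    [/\ finite_set Q, finite_set R, finite_set Phi,
        (forall f, Phi f -> monoid_morphism f)
      & isomorphic_groups G (quotient_group (Q `|` iterated_images Phi R))].

(* Main.v *)
Require Import Defs.
From mathcomp Require Import all_boot.
From mathcomp Require Import boolp classical_sets functions cardinality.

Set Implicit Arguments.
Unset Strict Implicit.
Unset Printing Implicit Defensive.

Local Open Scope classical_set_scope.
Local Open Scope group_scope.
Local Open Scope quotient_scope.

(** The three kinds of presentation are linked in a cycle: EDT0L gives a finite L-presentation
    ([EDT0L_has_finite_L_presentation]), which gives DTF0L+FIN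
    ([has_finite_L_presentation_DTF0L_FIN]), and DTF0L+FIN languages are EDT0L
    ([DTF0L_FIN_sub_EDT0L]). The first link is the hard one: an L-presentation cannot discard the
    words that still contain non-terminals, so these would impose unwanted relations. The remedy is
    to tag each letter with a guessed set of letters, so that a wrong guess collapses the word to 1
    and a right one certifies that the final word is terminal. All tagged generators are killed by
    the finite set [Q], so intermediate tagged words impose nothing more, and retracting onto the
    free group on [S] identifies the two quotients. *)

(** * Iterated images as a least stable set *)

Section IteratedImages.
Variables (T : Type) (Phi : set (T -> T)).
Implicit Types W P : set T.

Lemma sub_iterated_images W : W `<=` iterated_images Phi W.
Proof. by move=> w Ww; exists 0 => //; exists w => //; exists id. Qed.

Lemma iterated_images_step W f x :
  Phi f -> iterated_images Phi W x -> iterated_images Phi W (f x).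
Proof.
move=> Pf [n _ [w Ww [h hn <-]]]; exists n.+1 => //; exists w => //.
by exists (f \o h) => //; exists f => //; exists h.
Qed.

(** Compositions grow on the left, so the map peeled off is the last one applied. With the two
    preceding lemmas this characterises [iterated_images Phi W] as the least set containing [W] and
    stable under [Phi]. *)
Lemma iterated_images_ind W P :
  W `<=` P -> (forall f x, Phi f -> P x -> P (f x)) ->
  iterated_images Phi W `<=` P.
Proof.
move=> WP stepP _ [n _ [w Ww [h hn <-]]]; elim: n h hn => [|n IH] h /=.
  by move=> ->; apply: WP.
by move=> [f Pf [g gn <-]]; apply: (stepP f) => //; apply: IH.
Qed.

End IteratedImages.

Lemma monoid_morphism_comp (G H K : baseUMagmaType) (f : H -> K) (g : G -> H) :
  monoid_morphism f -> monoid_morphism g -> monoid_morphism (f \o g).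
Proof. by move=> [f1 fM] [g1 gM]; split=> [|x y] /=; rewrite ?g1 ?gM. Qed.

Lemma monoid_morphismV (G H : groupType) (f : G -> H) :
  monoid_morphism f -> {morph f : x / x^-1}.
Proof.
move=> [f1 fM] x; apply/esym/mulg1_eq.
by rewrite -fM mulgV f1.
Qed.

Lemma map_monoid_morphism (A B : choiceType) (f : A -> B) :
  monoid_morphism (map f).
Proof. by split=> // u v; apply: map_cat. Qed.

(** * Universal properties of free monoids and free groups *)

Section FreeMonoid.
Variables (A : choiceType) (M : monoidType).

Definition word_hom (c : A -> M) (u : seq A) : M := \prod_(a <- u) c a.

Lemma word_hom_morphism c : monoid_morphism (word_hom c).
Proof. by split=> [|u v]; [apply: big_nil|apply: big_cat]. Qed.

Lemma word_hom1 c a : word_hom c [:: a] = c a.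
Proof. exact: big_seq1. Qed.

Lemma word_hom_ext (f g : seq A -> M) :
  monoid_morphism f -> monoid_morphism g ->
  (forall a, f [:: a] = g [:: a]) -> f =1 g.
Proof.
move=> [f1 fM] [g1 gM] fg; elim=> [|a u IH]; first by rewrite f1 g1.
by rewrite (fM [:: a] u) (gM [:: a] u) fg IH.
Qed.

End FreeMonoid.

Section FreeGroupHom.
Variable S : finType.

Lemma word_val_morphism : monoid_morphism (@word_val S).
Proof. by split=> // u v; apply: word_val_cat. Qed.

Definition gen (s : S) : free_group S := word_val [:: (s, false)].

Lemma word_val_letter a :
  word_val [:: a] = if a.2 then (gen a.1)^-1 else gen a.1.
Proof.
by case: a => s [] //=; rewrite -[LHS]/(word_val (word_inv [:: (s, false)]))
  word_val_inv.
Qed.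

Variable G : groupType.

Definition free_hom (g : S -> G) (p : free_group S) : G :=
  word_hom (fun a : letter S => if a.2 then (g a.1)^-1 else g a.1) (repr p).

(** A cancelling pair contributes an element times its inverse, so evaluation is constant on free
    equivalence classes and the choice of [repr] does not matter. *)
Lemma free_hom_word_val g u : free_hom g (word_val u) =
  word_hom (fun a : letter S => if a.2 then (g a.1)^-1 else g a.1) u.
Proof.
have : free_eq (repr (word_val u)) u by apply/word_valP; rewrite /word_val reprK.
rewrite /free_hom; set c := fun a => _.
have [c1 cM] := word_hom_morphism c.
move: (repr _) => v; elim=> [x a y|x|x y _ ->|x y z _ -> _ ->] //.
rewrite (cM x (a :: _)) (cM x y) (cM [:: a] (_ :: y)) (cM [:: letter_inv a] y).
by rewrite !word_hom1 /c; case: a => s [] /=; rewrite ?mulKg ?mulVKg.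
Qed.

Lemma free_hom_morphism g : monoid_morphism (free_hom g).
Proof.
split; first by rewrite [LHS]free_hom_word_val (word_hom_morphism _).1.
elim/free_group_ind=> x; elim/free_group_ind=> y.
rewrite -[_ * _]word_val_cat !free_hom_word_val.
exact: (word_hom_morphism _).2.
Qed.

Lemma free_hom_gen g s : free_hom g (gen s) = g s.
Proof. by rewrite free_hom_word_val word_hom1. Qed.

Lemma free_hom_ext (f g : free_group S -> G) :
  monoid_morphism f -> monoid_morphism g ->
  (forall s, f (gen s) = g (gen s)) -> f =1 g.
Proof.
move=> fM gM fg; elim/free_group_ind.
apply: (@word_hom_ext _ _ (f \o @word_val S) (g \o @word_val S)).
- exact: monoid_morphism_comp fM word_val_morphism.
- exact: monoid_morphism_comp gM word_val_morphism.
move=> a /=; rewrite word_val_letter.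
by case: ifP => _; rewrite ?monoid_morphismV ?fg.
Qed.

End FreeGroupHom.

(** * Homomorphisms between quotients by normal closures *)

Section Quotients.

Lemma sub_normal_closure (G : groupType) (X : set G) : X `<=` normal_closure X.
Proof. by move=> x Xx N [_]; apply. Qed.

(** The preimage of a normal subgroup under a morphism is normal, and here it contains [X]. *)
Lemma normal_closure_morphism (G H : groupType) (X : set G) (Y : set H)
    (f : G -> H) :
  monoid_morphism f -> (forall x, X x -> normal_closure Y (f x)) ->
  forall x, normal_closure X x -> normal_closure Y (f x).
Proof.
move=> fM XY x Nx; apply: (Nx [set z | normal_closure Y (f z)]); split=> //.
have [[N1 NM NV] NJ] := normal_closure_normal Y.
have fV := monoid_morphismV fM; case: fM => f1 fM.
split; first split=> [|a b Na Nb|a Na] /=; rewrite ?f1 ?fM ?fV //.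
- exact: NM.
- exact: NV.
- by move=> a b /= Na; rewrite /conjg !fM fV; apply: NJ.
Qed.

Definition quotient_map (G : groupType) (X : set G) (x : G) : quotient_group X :=
  \pi_(quotient_group X) x.

Lemma quotient_map_morphism (G : groupType) (X : set G) :
  monoid_morphism (quotient_map X).
Proof. by split=> // x y; apply: quotient_group_piM. Qed.

Lemma quotient_mapP (G : groupType) (X : set G) x y :
  quotient_map X x = quotient_map X y <-> normal_closure X (x^-1 * y).
Proof. exact: quotient_group_piP. Qed.

Lemma quotient_mapK (G : groupType) (X : set G) (q : quotient_group X) :
  quotient_map X (repr q) = q.
Proof. exact: reprK. Qed.

(** Relators going to consequences of relators, [i] and [p] descend to the quotients; they need to
    be mutually inverse only modulo the relators. *)
Lemma quotient_group_iso (G H : groupType) (X : set G) (Y : set H)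
    (i : G -> H) (p : H -> G) :
  monoid_morphism i -> monoid_morphism p ->
  (forall x, X x -> normal_closure Y (i x)) ->
  (forall y, Y y -> normal_closure X (p y)) ->
  (forall x, quotient_map X (p (i x)) = quotient_map X x) ->
  (forall y, quotient_map Y (i (p y)) = quotient_map Y y) ->
  isomorphic_groups (quotient_group X) (quotient_group Y).
Proof.
have induced (G1 H1 : groupType) (X1 : set G1) (Y1 : set H1) (f : G1 -> H1) :
    monoid_morphism f -> (forall x, X1 x -> normal_closure Y1 (f x)) ->
    forall x, quotient_map Y1 (f (repr (quotient_map X1 x))) =
              quotient_map Y1 (f x).
  move=> fM XY x; apply/quotient_mapP.
  rewrite -monoid_morphismV // -fM.2; apply: (normal_closure_morphism fM XY).
  by apply/quotient_mapP; rewrite quotient_mapK.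
move=> iM pM XY YX pi_id ip_id.
have iE := induced _ _ _ _ _ iM XY; have pE := induced _ _ _ _ _ pM YX.
exists (fun q => quotient_map Y (i (repr q))); split.
  split; first by rewrite [LHS]iE iM.1.
  elim/quotient_group_ind=> x; elim/quotient_group_ind=> y.
  rewrite -/(quotient_map X x) -/(quotient_map X y).
  by rewrite -(quotient_map_morphism X).2 !iE iM.2 (quotient_map_morphism Y).2.
exists (fun q => quotient_map X (p (repr q))).
- by elim/quotient_group_ind=> x; rewrite iE pE pi_id.
- by elim/quotient_group_ind=> y; rewrite pE iE ip_id.
Qed.

Lemma isomorphic_groups_trans (G H K : groupType) :
  isomorphic_groups G H -> isomorphic_groups H K -> isomorphic_groups G K.
Proof.
move=> [f [fM fB]] [g [gM gB]]; exists (g \o f).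
by split; [apply: monoid_morphism_comp|apply: bij_comp].
Qed.

End Quotients.

(** * From DTF0L+FIN to EDT0L *)

(* Copying the letters as non-terminals [inr (Some a)] confines the DTF0L
   morphisms to the copies; the start symbol is [inr None]. *)
Lemma DTF0L_FIN_sub_EDT0L (A : finType) : @DTF0L_FIN A `<=` @EDT0L A.
Proof.
move=> _ [_ [F [[W0 [Phi [finW finPhi PhiM ->]] finF ->]]]].
pose B : finType := (A + option A)%type.
pose copy : seq A -> seq B := map (inr \o Some).
pose subst (n : seq B) (c : A -> seq B) : seq B -> seq B :=
  word_hom (fun x : B => match x with
                     | inr None => n | inr (Some a) => c a | inl a => [:: inl a]
                     end).
have substM n c : monoid_morphism (subst n c) by apply: word_hom_morphism.
have subst_start n c : subst n c [:: inr None] = n by apply: word_hom1.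
have subst_inl n c u : subst n c (map inl u) = map inl u.
  apply: (word_hom_ext (f := subst n c \o map inl)).
  - exact: monoid_morphism_comp (substM n c) (map_monoid_morphism _).
  - exact: map_monoid_morphism.
  - by move=> a /=; apply: word_hom1.
have subst_copy n c f : monoid_morphism f -> (forall a, c a = f [:: a]) ->
    forall u, subst n c (copy u) = f u.
  move=> fM cf; apply: (word_hom_ext (f := subst n c \o copy)) => //.
  - exact: monoid_morphism_comp (substM n c) (map_monoid_morphism _).
  - by move=> a /=; rewrite -cf; apply: word_hom1.
pose start : seq B := [:: inr None].
pose fcopy a := copy [:: a].
pose step (f : seq A -> seq A) := subst start (fun a => copy (f [:: a])).
pose stop := subst start (fun a => [:: inl a]).
(* The start symbol becomes either a copied word of [W0] or, at once, a terminal word of [F]; [step]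
   simulates [Phi] on copies and [stop] turns copies into terminals. *)
pose Psi : set (seq B -> seq B) :=
  [set subst (copy w) fcopy | w in W0] `|` [set subst (map inl w) fcopy | w in F]
  `|` [set step f | f in Phi] `|` [set stop].
exists (option A), start, Psi.
have stepE f u : Phi f -> step f (copy u) = copy (f u).
  move=> /PhiM fM; apply: (subst_copy _ _ (copy \o f)) => //.
  exact: monoid_morphism_comp (map_monoid_morphism _) fM.
have stopE u : stop (copy u) = map inl u.
  by apply: subst_copy => //; apply: map_monoid_morphism.
split.
- rewrite !finite_setU; split; last exact: finite_set1.
  by split; [split|]; apply: finite_image.
- by move=> f [[[|]|]|->] => [[w _ <-]|[w _ <-]|[g _ <-]|]; apply: substM.
have fcopyE n u : subst n fcopy (copy u) = copy u.
  by apply: subst_copy => //; apply: map_monoid_morphism.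
have inl_inj : injective (map (@inl A (option A))).
  by apply: inj_map => a b [].
have copy_inl u v : copy u = map inl v -> u = [::] /\ v = [::].
  by case: u v => [|a u] [|b v].
have reach_copy u : iterated_images Phi W0 u ->
    iterated_images Psi [set start] (copy u).
  apply: (@iterated_images_ind _ _ _ (fun u => iterated_images Psi _ (copy u))).
    move=> w Ww; rewrite -(subst_start (copy w) fcopy).
    apply: iterated_images_step; last exact: sub_iterated_images.
    by left; left; left; exists w.
  move=> f x Pf IH; rewrite -stepE //; apply: iterated_images_step => //.
  by left; right; exists f.
apply/seteqP; split=> u /=.
  case=> [/reach_copy Lu|Fu].
    by rewrite -stopE; apply: iterated_images_step => //; right.
  rewrite -(subst_start (map inl u) fcopy).
  apply: iterated_images_step; last exact: sub_iterated_images.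
  by left; left; right; exists u.
(* Maps applied out of turn are harmless: [step] and [stop] fix the start symbol, the initial maps
   fix copied words, and every map fixes terminal words. *)
pose P : set (seq B) := fun x => [\/ x = start,
  exists2 v, iterated_images Phi W0 v & x = copy v
  | exists2 v, (iterated_images Phi W0 `|` F) v & x = map inl v].
have PsiP : iterated_images Psi [set start] `<=` P.
  apply: iterated_images_ind => [_ ->|f x Psif]; first by constructor 1.
  case=> [->|[v Lv ->]|[v Lv ->]]; last 1 first.
  - case: Psif => [[[|]|]|->] => [[w _ <-]|[w _ <-]|[g _ <-]|];
      by constructor 3; exists v => //; apply: subst_inl.
  - case: Psif => [[[|]|]|->] => [[w Ww <-]|[w Fw <-]|[g Pg <-]|].
    + by constructor 2; exists w; [apply: sub_iterated_images|].
    + by constructor 3; exists w; [right|].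
    + by constructor 1; apply: subst_start.
    + by constructor 1; apply: subst_start.
  - case: Psif => [[[|]|]|->] => [[w Ww <-]|[w Fw <-]|[g Pg <-]|].
    + by constructor 2; exists v.
    + by constructor 2; exists v.
    + by constructor 2; exists (g v); [apply: iterated_images_step|apply: stepE].
    + by constructor 3; exists v; [left|].
case/PsiP => [|[v Lv]|[v Lv /inl_inj ->] //]; first by case: u => [|? []].
(* A copied word is terminal only if it is empty, and then it is itself the word of the DTF0L
   language. *)
by move=> /esym/copy_inl[v0 ->]; left; rewrite -v0.
Qed.

(** * From finite L-presentations to DTF0L+FIN *)

Lemma has_finite_L_presentation_DTF0L_FIN (G : groupType) :
  has_finite_L_presentation G -> has_presentation_in DTF0L_FIN G.
Proof.
move=> [S [Q [R [Phi [finQ finR finPhi PhiM isoG]]]]].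
(* Inverse letters are independent letters here: each gets its own chosen representative, and
   [word_val] intertwines [lift f] with [f] because it does so on letters. *)
pose lift (f : free_group S -> free_group S) : seq (letter S) -> seq (letter S) :=
  word_hom (fun a => repr (f (word_val [:: a]))).
have liftE f : Phi f -> forall u, word_val (lift f u) = f (word_val u).
  move=> /PhiM fM; apply: (word_hom_ext (f := @word_val S \o lift f)
                                        (g := f \o @word_val S)).
  - exact: monoid_morphism_comp (word_val_morphism S) (word_hom_morphism _).
  - exact: monoid_morphism_comp fM (word_val_morphism S).
  - by move=> a /=; rewrite /lift word_hom1 /word_val reprK.
have reprE (X : set (free_group S)) : @word_val S @` (repr @` X) = X.
  apply/seteqP; split=> [_ [_ [x Xx <-] <-]|x Xx]; first by rewrite /word_val reprK.
  by exists (repr x); [exists x|rewrite /word_val reprK].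
exists S, (iterated_images (lift @` Phi) (repr @` R) `|` (repr @` Q)); split.
  exists (iterated_images (lift @` Phi) (repr @` R)), (repr @` Q).
  split=> //; last exact: finite_image.
  exists (repr @` R), (lift @` Phi); split=> //; try exact: finite_image.
  by move=> _ [f _ <-]; apply: word_hom_morphism.
rewrite image_setU reprE setUC.
suff -> : @word_val S @` iterated_images (lift @` Phi) (repr @` R) =
          iterated_images Phi R by [].
apply/seteqP; split=> [_ [u Lu <-]|].
  move: u Lu; apply: (iterated_images_ind (P := fun u => _ (word_val u))).
    by move=> _ [x Rx <-]; rewrite /word_val reprK; apply: sub_iterated_images.
  move=> _ u [f Pf <-] IH; rewrite liftE //; exact: iterated_images_step.
apply: iterated_images_ind => [x Rx|f _ Pf [u Lu <-]].
  exists (repr x); last by rewrite /word_val reprK.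
  by apply: sub_iterated_images; exists x.
exists (lift f u); last exact: liftE.
by apply: iterated_images_step => //; exists f.
Qed.

(** * From EDT0L to finite L-presentations *)

(* A terminal word [h w0], with [h] a composition of maps in [Phi], is
   recognised by pulling the set of terminals back through [h]: the letters of
   [w0] must lie in the last of the sets [V_0] = terminals,
   [V_(k+1)] = letters sent by the next map to words over [V_k].  The free group
   below has one copy [x_V] of each letter [x] for each set [V] of letters;
   [step f V] sends [x_V'] to [(f x)_V] if [V'] is the pullback of [V] and to 1
   otherwise, so that only correct guesses of the sequence [V_k] survive. *)
Lemma EDT0L_has_finite_L_presentation (G : groupType) :
  has_presentation_in EDT0L G -> has_finite_L_presentation G.
Proof.
move=> [S [L [[E [w0 [Phi [finPhi PhiM LE]]]] isoG]]].
pose B : finType := (letter S + E)%type.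
(* The tagged copies of a letter and of its formal inverse are unrelated generators; only [stop]
   makes them mutually inverse. *)
pose S' : finType := (S + B * {set B})%type.
pose emb (V : {set B}) : seq B -> free_group S' :=
  word_hom (fun x => gen (inr (x, V))).
have embM V : monoid_morphism (emb V) by apply: word_hom_morphism.
pose incl : free_group S -> free_group S' := free_hom (fun s => gen (inl s)).
have inclM : monoid_morphism incl by apply: free_hom_morphism.
pose retr : free_group S' -> free_group S :=
  free_hom (fun y : S' => if y is inl s then gen s else 1).
have retrM : monoid_morphism retr by apply: free_hom_morphism.
pose ext (c : B * {set B} -> free_group S') : free_group S' -> free_group S' :=
  free_hom (fun y : S' => match y with inl s => gen (inl s) | inr z => c z end).
have extM c : monoid_morphism (ext c) by apply: free_hom_morphism.
have ext_incl c r : ext c (incl r) = incl r.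
  apply: (free_hom_ext (f := ext c \o incl)) => //.
    exact: monoid_morphism_comp.
  by move=> s /=; rewrite /incl free_hom_gen /ext free_hom_gen.
have ext_emb c V (f : seq B -> free_group S') : monoid_morphism f ->
    (forall x, c (x, V) = f [:: x]) -> forall w, ext c (emb V w) = f w.
  move=> fM cf; apply: (word_hom_ext (f := ext c \o emb V)) => //.
    exact: monoid_morphism_comp.
  by move=> x /=; rewrite -cf /emb word_hom1 /ext free_hom_gen.
have trivM : monoid_morphism (fun _ : seq B => 1 : free_group S').
  by split=> // x y; rewrite mulg1.
pose over (V : {set B}) (w : seq B) := all (mem V) w.
pose pullback (f : seq B -> seq B) (V : {set B}) := [set x | over V (f [:: x])]%SET.
pose terminals := [set x : B | if x is inl _ then true else false]%SET.
pose step (f : seq B -> seq B) V := ext (fun z =>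
  if z.2 == pullback f V then emb V (f [:: z.1]) else 1).
(* The inner 1, at non-terminals, is a default: words tagged [terminals] that are reached from [R]
   contain only terminals. *)
pose stop := ext (fun z => if z.2 == terminals then
  incl (word_hom (fun x => if x is inl a then word_val [:: a] else 1) [:: z.1])
  else 1).
have over_pullback f V w : Phi f -> over (pullback f V) w = over V (f w).
  move=> /PhiM [f1 fM]; elim: w => [|x w IH]; first by rewrite f1.
  by rewrite (fM [:: x] w) /over all_cat /= [all _ w]IH inE.
have over_terminals w : over terminals w -> exists u, w = map inl u.
  elim: w => [|[a|e] w IH] /=; first by exists [::].
    by case/andP=> _ /IH[u ->]; exists (a :: u).
  by rewrite inE.
have map_over u : over terminals (map inl u).
  by elim: u => //= a u ->; rewrite inE.
have stepE f V w : Phi f -> step f V (emb (pullback f V) w) = emb V (f w).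
  move=> /PhiM fM; apply: (ext_emb _ _ (emb V \o f)).
    exact: monoid_morphism_comp.
  by move=> x /=; rewrite eqxx.
have step1 f V V' w : V' != pullback f V -> step f V (emb V' w) = 1.
  by move=> /negPf VV'; apply: (ext_emb _ _ (fun=> 1)) => // x; rewrite /= VV'.
have stopE u : stop (emb terminals (map inl u)) = incl (word_val u).
  set c := fun x : B => if x is inl a then word_val [:: a] else 1.
  transitivity (incl (word_hom c (map inl u))).
    apply: (ext_emb _ _ (incl \o word_hom c)).
      exact: monoid_morphism_comp inclM (word_hom_morphism _).
    by move=> x; rewrite /= eqxx.
  congr (incl _); apply: (word_hom_ext (f := word_hom c \o map inl)).
  - exact: monoid_morphism_comp (word_hom_morphism _) (map_monoid_morphism _).
  - exact: word_val_morphism.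
  - by move=> a /=; rewrite word_hom1.
have stop1 V w : V != terminals -> stop (emb V w) = 1.
  by move=> /negPf VV'; apply: (ext_emb _ _ (fun=> 1)) => // x; rewrite /= VV'.
have retr_incl r : retr (incl r) = r.
  apply: (free_hom_ext (f := retr \o incl) (g := id)) => //.
    exact: monoid_morphism_comp.
  by move=> s /=; rewrite /incl free_hom_gen /retr free_hom_gen.
have retr_emb V w : retr (emb V w) = 1.
  apply: (word_hom_ext (f := retr \o emb V) (g := fun=> 1)).
  - exact: monoid_morphism_comp.
  - by split=> // x y; rewrite mulg1.
  - by move=> x /=; rewrite /emb word_hom1 /retr free_hom_gen.
pose X := @word_val S @` L.
pose Q : set (free_group S') := range (fun z => gen (inr z)).
pose R : set (free_group S') := [set emb V w0 | V in [set V | over V w0]].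
pose Psi : set (free_group S' -> free_group S') :=
  [set step fV.1 fV.2 | fV in Phi `*` setT] `|` [set stop].
exists S', Q, R, Psi; split.
- exact: finite_image.
- exact: finite_image.
- rewrite finite_setU; split; last exact: finite_set1.
  by apply: finite_image; apply: finite_setX.
- by move=> f [[fV _ <-]|->]; apply: extM.
apply: isomorphic_groups_trans isoG _; rewrite -/X.
pose inL w := iterated_images Phi [set w0] w.
(* The tag must be quantified inside the induction: to reach [f x] tagged [V], one needs [x] tagged
   [pullback f V]. *)
have reach w : inL w ->
    forall V, over V w -> iterated_images Psi R (emb V w).
  apply: (@iterated_images_ind _ _ _ (fun w => forall V, over V w ->
    iterated_images Psi R (emb V w))) => [_ -> V Vw0|f x Pf IH V].
    by apply: sub_iterated_images; exists V.
  rewrite -over_pullback // => /IH; rewrite -stepE //.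
  by apply: iterated_images_step; left; exists (f, V).
have NX1 : normal_closure X 1 by have [[]] := normal_closure_normal X.
(* Conversely, a wrong guess gives the trivial relator [incl 1], and a right one keeps the word over
   its tag, so [stop] yields only words of [L]. Untagged elements are fixed by every map. *)
have Psi_inv : iterated_images Psi R `<=`
    [set y | (exists2 r, normal_closure X r & y = incl r) \/
             exists V w, [/\ inL w, over V w & y = emb V w]].
  apply: iterated_images_ind => [_ [V Vw0 <-]|f y Psif].
    by right; exists V, w0; split=> //; apply: sub_iterated_images.
  case=> [[r Nr ->]|[V [w [Lw Vw ->]]]].
    left; exists r => //; case: Psif => [[fV _ <-]|->]; exact: ext_incl.
  case: Psif => [[[g U] /= [Pg _] <-]|->].
    have [VU|VU] := eqVneq V (pullback g U); last first.
      by left; exists 1; rewrite ?step1 ?inclM.1.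
    right; exists U, (g w); rewrite VU stepE // -over_pullback // -VU.
    by split=> //; apply: iterated_images_step.
  have [VT|VT] := eqVneq V terminals; last first.
    by left; exists 1; rewrite ?stop1 ?inclM.1.
  move: Vw; rewrite VT => /over_terminals[u wu]; left; exists (word_val u).
    by apply: sub_normal_closure; exists u; rewrite // LE /= -wu.
  by rewrite wu stopE.
apply: (quotient_group_iso (i := incl) (p := retr)) => //.
- move=> _ [u Lu <-]; apply: sub_normal_closure; right; rewrite -stopE.
  apply: iterated_images_step; first by right.
  by apply: reach => //; move: Lu; rewrite LE.
- move=> y [[z _ <-]|/Psi_inv[[r Nr ->]|[V [w [_ _ ->]]]]].
  + by rewrite /retr free_hom_gen.
  + by rewrite retr_incl.
  + by rewrite retr_emb.
- by move=> x; rewrite retr_incl.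
(* On generators, [incl \o retr] moves only the tagged ones, sending them to 1, and these lie in
   [Q]. *)
set N := Q `|` _; apply: (free_hom_ext (f := quotient_map N \o (incl \o retr))).
- apply: monoid_morphism_comp; first exact: quotient_map_morphism.
  exact: monoid_morphism_comp.
- exact: quotient_map_morphism.
case=> [s|z] /=; rewrite /retr free_hom_gen ?inclM.1.
  by rewrite /incl free_hom_gen.
apply/quotient_mapP; rewrite invg1 mul1g.
by apply: sub_normal_closure; left; exists z.
Qed.

Theorem theorem1 :
  (forall G : groupType, finitely_generated G ->
     (has_presentation_in EDT0L G <-> has_finite_L_presentation G)) /\
  (forall G : groupType,
     fg_groups_presented_in EDT0L G <-> fg_groups_presented_in DTF0L_FIN G).
Proof.
have toL := EDT0L_has_finite_L_presentation.
have toDTF0L := has_finite_L_presentation_DTF0L_FIN.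
have toEDT0L G : has_presentation_in DTF0L_FIN G -> has_presentation_in EDT0L G.
  by move=> [S [R [LR isoG]]]; exists S, R; split=> //; apply: DTF0L_FIN_sub_EDT0L.
split=> [G _|G]; first by split=> [/toL|/toDTF0L/toEDT0L].
split=> [[fgG presG]|[fgG presG]]; split=> //; last exact: toEDT0L.
exact/toDTF0L/toL.
Qed.
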